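(* Let $R=k[x_1,\dots,x_n]$ be a polynomial ring over a field $k$ and let $I\subset R$ be an arbitrary squarefree monomial ideal. For every integer $s\ge 1$ and every $t\in E(s)$, we have $\operatorname{depth} R/I^{(s)} \ge \operatorname{depth} R/I^{(t)}$, where $$E(s)=\bigcup_{i\ge 1}\{t\in\mathbb{N} \mid i(s-1)+1\le t\le is\}.$$
   Context: For a homogeneous ideal $I$ of $R$ and $t\ge 0$, the $t$-th symbolic power $I^{(t)}$ is the intersection of the primary components of $I^t$ associated with the minimal primes of $I$. *)

(* Defs.v *)
From HB Require Import structures.
From mathcomp Require Import all_boot all_algebra.
From mathcomp Require Import mpoly.
Set Implicit Arguments. Unset Strict Implicit. Unset Printing Implicit Defensive.
Import GRing.Theory.
Local Open Scope ring_scope.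

Section Defs.
Variables (k : fieldType) (n : nat).
Local Notation R := {mpoly k[n]}.

Definition is_ideal (J : R -> Prop) : Prop :=
  [/\ J 0, (forall a b, J a -> J b -> J (a + b)) & (forall r a, J a -> J (r * a))].

Definition ideal_gen (S : R -> Prop) : R -> Prop :=
  fun f => forall J, is_ideal J -> (forall g, S g -> J g) -> J f.

Definition pow_ideal (I : R -> Prop) (t : nat) : R -> Prop :=
  ideal_gen (fun f => exists s : seq R,
     [/\ size s = t, (forall g, g \in s -> I g) & f = \prod_(g <- s) g]).

Definition is_prime_ideal (P : R -> Prop) : Prop :=
  [/\ is_ideal P, ~ P 1 & (forall a b, P (a * b) -> P a \/ P b)].

Definition is_minimal_prime (I P : R -> Prop) : Prop :=
  [/\ is_prime_ideal P, (forall f, I f -> P f) &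
      (forall Q, is_prime_ideal Q -> (forall f, I f -> Q f) ->
                 (forall f, Q f -> P f) -> forall f, P f -> Q f)].

(* t-th symbolic power: intersection over the minimal primes P of I of the
   P-primary component of I^t, i.e. of I^t R_P \cap R
   = { f | exists u \notin P, u f \in I^t }. *)
Definition symb_pow (I : R -> Prop) (t : nat) : R -> Prop :=
  fun f => forall P, is_minimal_prime I P ->
    exists u, ~ P u /\ pow_ideal I t (u * f).

Definition sqfree_monomial_ideal (I : R -> Prop) : Prop :=
  exists S : 'X_{1..n} -> Prop,
    (forall m, S m -> forall i : 'I_n, (m i <= 1)%N) /\
    (forall f, I f <-> ideal_gen (fun g => exists m, S m /\ g = 'X_[m]) f).

Definition max_ideal : R -> Prop := ideal_gen (fun g => exists i : 'I_n, g = 'X_i).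

Definition ideal_add (J : R -> Prop) (fs : seq R) : R -> Prop :=
  ideal_gen (fun g => J g \/ g \in fs).

Definition regular_seq (J : R -> Prop) (fs : seq R) : Prop :=
  (forall i, (i < size fs)%N -> forall g,
     ideal_add J (take i fs) (nth 0 fs i * g) -> ideal_add J (take i fs) g)
  /\ ~ ideal_add J fs 1.

(* depth R/J >= d : R/J = 0 (depth of the zero module is infinite), or there is
   an R/J-regular sequence of length d inside the maximal ideal *)
Definition depth_ge (J : R -> Prop) (d : nat) : Prop :=
  J 1 \/ exists fs : seq R,
    [/\ size fs = d, (forall f, f \in fs -> max_ideal f) & regular_seq J fs].

(* depth R/J <= depth R/J' (depth = sup of the d with depth_ge, in nat \cup {oo}) *)
Definition depth_leq (J J' : R -> Prop) : Prop :=
  forall d, depth_ge J d -> depth_ge J' d.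

End Defs.

Definition E_set (s t : nat) : Prop :=
  exists i : nat, [/\ (1 <= i)%N, (i * (s - 1) + 1 <= t)%N & (t <= i * s)%N].

(* Main.v *)
From HB Require Import structures.
Require Import Defs.
From mathcomp Require Import all_boot all_order all_algebra.
From mathcomp Require Import ssrcomplements mpoly ring.
From Stdlib Require Import Classical ClassicalEpsilon FunctionalExtensionality PropExtensionality.
Set Implicit Arguments. Unset Strict Implicit. Unset Printing Implicit Defensive.
Import Order.TTheory GRing.Theory.
Local Open Scope ring_scope.

(** Every minimal prime of I is generated by a set F of variables, and f lies in
    I^(t) iff every monomial of f has total degree at least t in the variables
    of F, for each such F.  Hence, if e(s-1)+1 <= t <= es, the endomorphism
    x_j -> x_j^e maps I^(s) into I^(t), and its linear retraction, which sends
    x^(ea) to x^a and kills the other monomials, maps I^(t) into I^(s): through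
    this endomorphism R/I^(s) is a direct summand of R/I^(t).

    It remains to find, from an arbitrary R/I^(t)-regular sequence, one of the
    same length whose elements lie in the image of x_j -> x_j^e.  By prime
    avoidance an element h of the maximal ideal can be chosen such that the
    image of h is regular, and by the exchange property of regular sequences,
    dividing by any regular element drops the attainable length by just one. *)

(** * Noetherianity *)

Lemma prop_ex_minn (P : nat -> Prop) :
  (exists m, P m) -> exists2 m, P m & forall j, P j -> (m <= j)%N.
Proof.
case=> m; elim/ltn_ind: m => m IH Pm.
case: (classic (exists2 j, (j < m)%N & P j)) => [[j jm Pj]|H]; first exact: IH jm Pj.
exists m => // j Pj; rewrite leqNgt; apply/negP => jm; apply: H; by exists j.
Qed.

(** Repeatedly jump to a later index at which [v] attains its minimum over the rest of the
    sequence. *)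
Lemma nat_seq_monotone_subseq (v : nat -> nat) :
  exists s : nat -> nat, {homo s : i j / (i < j)%N} /\
    forall i j, (i <= j)%N -> (v (s i) <= v (s j))%N.
Proof.
have nextP N : exists j, (N <= j)%N /\ forall l, (N <= l)%N -> (v j <= v l)%N.
  have [|m [j [Nj <-]] H] := @prop_ex_minn (fun m => exists j, (N <= j)%N /\ v j = m).
    by exists (v N), N.
  exists j; split=> // l Nl; apply: H; by exists l.
pose next N := sval (constructive_indefinite_description _ (nextP N)).
have nextE N : (N <= next N)%N /\ forall l, (N <= l)%N -> (v (next N) <= v l)%N.
  by rewrite /next; case: constructive_indefinite_description.
pose s := fix s j := if j is j'.+1 then next (s j').+1 else next 0.
have sS j : (s j < s j.+1)%N by case: (nextE (s j).+1).
have s_mono := homo_ltn ltn_trans sS.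
exists s; split=> // i j; rewrite leq_eqVlt => /predU1P[->//|/s_mono ij].
case: i ij => [|i] ij; first by case: (nextE 0) => _; apply.
case: (nextE (s i).+1) => _; apply; exact: leq_trans (sS i) (ltnW ij).
Qed.

(** Passing once per variable to a subsequence along which that coordinate is monotone makes the
    first two terms comparable. *)
Lemma dickson n (a : nat -> 'X_{1..n}) : exists i j, (i < j)%N /\ (a i <= a j)%MM.
Proof.
suff /(_ n)[s [s_mono H]]: forall d, exists s : nat -> nat, {homo s : i j / (i < j)%N} /\
    forall (c : 'I_n), (c < d)%N -> forall i j, (i <= j)%N -> (a (s i) c <= a (s j) c)%N.
  exists (s 0%N), (s 1%N); split; first exact: s_mono.
  by apply/mnm_lepP => c; apply: H.
elim=> [|d [s [s_mono H]]]; first (exists id; split=> //).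
case: (ltnP d n) => [dn|nd]; last first.
  exists s; split=> // c _; apply: H; exact: leq_trans (ltn_ord c) nd.
have [r [r_mono Hr]] := nat_seq_monotone_subseq (fun l => a (s l) (Ordinal dn)).
exists (s \o r); split=> [i j ij|c]; first exact/s_mono/r_mono.
rewrite ltnS leq_eqVlt => /predU1P[cd|cd] i j ij.
  by have -> : c = Ordinal dn; [exact/val_inj | exact: Hr].
apply: (H c cd) => /=; move: ij; rewrite leq_eqVlt => /predU1P[->//|/r_mono]; exact: ltnW.
Qed.

Section Ideals.
Variables (k : fieldType) (n : nat).
Local Notation R := {mpoly k[n]}.
Implicit Types (J P : R -> Prop) (f g h u : R).

Lemma pred_ext J1 J2 : (forall f, J1 f <-> J2 f) -> J1 = J2.
Proof.
move=> H; apply: functional_extensionality => f; exact: propositional_extensionality.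
Qed.

Section IdealTheory.
Variables (J : R -> Prop) (idJ : is_ideal J).

Lemma ideal0 : J 0. Proof. by case: idJ. Qed.
Lemma idealD f g : J f -> J g -> J (f + g). Proof. by case: idJ => _ H _; exact: H. Qed.
Lemma ideal_mull f g : J g -> J (f * g). Proof. by case: idJ => _ _; apply. Qed.
Lemma ideal_mulr f g : J g -> J (g * f). Proof. by rewrite mulrC; exact: ideal_mull. Qed.
Lemma idealN f : J f -> J (- f). Proof. by rewrite -mulN1r; exact: ideal_mull. Qed.
Lemma idealB f g : J f -> J g -> J (f - g).
Proof. by move=> Jf /idealN; exact: idealD. Qed.
Lemma idealZ c f : J f -> J (c *: f).
Proof. by rewrite -mul_mpolyC; exact: ideal_mull. Qed.
Lemma ideal_subr f g : J (f - g) -> J f <-> J g.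
Proof.
move=> H; split=> K; last by rewrite -(subrK g f); exact: idealD.
by rewrite -(subKr f g); exact: idealB.
Qed.
Lemma ideal_sum (T : eqType) (r : seq T) (F : T -> R) :
  (forall x, x \in r -> J (F x)) -> J (\sum_(x <- r) F x).
Proof.
elim: r => [|x r IH] H; first by rewrite big_nil; exact: ideal0.
rewrite big_cons; apply: idealD; first by apply: H; rewrite mem_head.
by apply: IH => y yr; apply: H; rewrite in_cons yr orbT.
Qed.

End IdealTheory.

Lemma ideal_gen_is_ideal (S : R -> Prop) : is_ideal (ideal_gen S).
Proof.
split=> [J idJ _|a b Ha Hb J idJ SJ|r a Ha J idJ SJ]; first exact: ideal0.
  by apply: idealD; [| exact: Ha | exact: Hb].
by apply: ideal_mull => //; exact: Ha.
Qed.

Lemma ideal_gen_sub (S : R -> Prop) f : S f -> ideal_gen S f.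
Proof. by move=> Sf J _; apply. Qed.

Lemma ideal_ind (Q : R -> Prop) (S : R -> Prop) :
  is_ideal Q -> (forall f, S f -> Q f) -> forall f, ideal_gen S f -> Q f.
Proof. by move=> idQ SQ f; apply. Qed.

(** The ideal J + (f), with an explicit cofactor of [f], so that membership proofs reduce to ring
    identities. *)
Definition adjoin J f : R -> Prop := fun g => exists a, J (g - a * f).

Lemma adjoin_ideal J f : is_ideal J -> is_ideal (adjoin J f).
Proof.
move=> idJ; split=> [|a b [a' Ha] [b' Hb]|r a [a' Ha]].
- by exists 0; rewrite mul0r subr0; exact: ideal0.
- exists (a' + b'); have -> : a + b - (a' + b') * f = (a - a' * f) + (b - b' * f) by ring.
  exact: idealD.
- exists (r * a'); have -> : r * a - r * a' * f = r * (a - a' * f) by ring.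
  exact: ideal_mull.
Qed.

Lemma adjoin_sub J f g : J g -> adjoin J f g.
Proof. by exists 0; rewrite mul0r subr0. Qed.

Lemma adjoin_gen J f : is_ideal J -> adjoin J f f.
Proof. by move=> idJ; exists 1; rewrite mul1r subrr; exact: ideal0. Qed.

Lemma adjoin_min J J' f : is_ideal J' -> (forall g, J g -> J' g) -> J' f ->
  forall g, adjoin J f g -> J' g.
Proof.
move=> idJ' JJ' J'f g [a Ha]; rewrite -(subrK (a * f) g).
by apply: idealD; [| exact: JJ' | exact: ideal_mull].
Qed.

Lemma adjoinAC J f g : adjoin (adjoin J f) g = adjoin (adjoin J g) f.
Proof.
apply: pred_ext => h; split=> -[a [b H]]; exists b, a; by rewrite addrAC.
Qed.

(* In a strictly increasing sequence A_j choose f_j in A_(j+1) \ A_j with least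
   leading monomial; by Dickson's lemma some f_j can be reduced by an earlier f_i. *)
Theorem noetherian (F : (R -> Prop) -> Prop) :
  (forall J, F J -> is_ideal J) -> (exists J, F J) ->
  exists2 J, F J & forall J', F J' -> (forall f, J f -> J' f) -> forall f, J' f -> J f.
Proof.
move=> Fid [J0 FJ0]; apply: NNPP => noMax.
have step J : F J -> exists J', F J' /\ (forall f, J f -> J' f) /\ exists f, J' f /\ ~ J f.
  move=> FJ; apply: NNPP => H; apply: noMax; exists J => // J' FJ' JJ' f J'f.
  apply: NNPP => nJf; apply: H; exists J'; split=> //; split=> //; by exists f.
pose T := {J | F J}.
have stepT (A : T) : exists B : T,
    (forall f, sval A f -> sval B f) /\ exists f, sval B f /\ ~ sval A f.
  case: A => J FJ /=; have [J' [FJ' H]] := step J FJ; by exists (exist _ J' FJ').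
pose next A := sval (constructive_indefinite_description _ (stepT A)).
have nextP A : (forall f, sval A f -> sval (next A) f) /\ exists f, sval (next A) f /\ ~ sval A f.
  by rewrite /next; case: constructive_indefinite_description.
pose A j := iter j next (exist _ J0 FJ0 : T).
have idA j : is_ideal (sval (A j)) by apply: Fid; case: (A j).
have A_mono i j f : (i <= j)%N -> sval (A i) f -> sval (A j) f.
  elim: j => [|j IH]; first by rewrite leqn0 => /eqP->.
  rewrite leq_eqVlt => /predU1P[->//|ij] Af; apply: (proj1 (nextP _)); exact: IH.
have minf j : exists f, [/\ sval (A j.+1) f, ~ sval (A j) f &
    forall g, sval (A j.+1) g -> (mlead g < mlead f)%O -> sval (A j) g].
  have [_ [f]] := nextP (A j); elim/mleadrect: f => f IH [Bf nAf].
  case: (classic (exists g, (mlead g < mlead f)%O /\ sval (A j.+1) g /\ ~ sval (A j) g)).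
    by case=> g [gf H]; exact: IH gf H.
  move=> H; exists f; split=> // g Bg gf; apply: NNPP => nAg; apply: H; by exists g.
pose f j := sval (constructive_indefinite_description _ (minf j)).
have fP j : [/\ sval (A j.+1) (f j), ~ sval (A j) (f j) &
    forall g, sval (A j.+1) g -> (mlead g < mlead (f j))%O -> sval (A j) g].
  by rewrite /f; case: constructive_indefinite_description.
have fN0 j : f j != 0 by apply/eqP => f0; case: (fP j) => _ + _; rewrite f0; case; exact: ideal0.
have [i [j [ij le_ij]]] := dickson (fun l => mlead (f l)).
have [Afj nAfj minj] := fP j; apply: nAfj.
have Afi : sval (A j) (f i) by apply: (@A_mono i.+1) => //; case: (fP i).
pose w := (mleadc (f j) / mleadc (f i)) *: 'X_[mlead (f j) - mlead (f i)] * f i.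
have Aw : sval (A j) w by exact: ideal_mull.
apply/(ideal_subr (idA j) (g := f j - w)); first by rewrite opprB addrC subrK.
case: (eqVneq (f j - w) 0) => [->|N0]; first exact: ideal0.
apply: minj; first by apply: idealB => //; exact: A_mono Aw.
have lc : mleadc (f i) != 0 by rewrite mleadc_eq0.
have lcj : mleadc (f j) != 0 by rewrite mleadc_eq0.
have c0 : mleadc (f j) / mleadc (f i) != 0 by rewrite mulf_neq0 ?invr_eq0.
have lw : mlead w = mlead (f j).
  rewrite /w -scalerAl mleadZ // mulrC mleadM //; first by rewrite mleadXm addmC submK.
  by rewrite -mleadc_eq0 mleadXm mcoeffX eqxx oner_eq0.
have cw : w@_(mlead (f j)) = mleadc (f j).
  have := mcoeffMX (f i) (mlead (f j) - mlead (f i))%MM (mlead (f i)).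
  by rewrite submK // mulrC /w -scalerAl mcoeffZ => ->; rewrite divfK.
rewrite lt_neqAle; apply/andP; split.
  by apply: contra N0 => /eqP E; rewrite -mleadc_eq0 E mcoeffB cw subrr.
by rewrite (le_trans (mleadB_le _ _)) // lw joinxx.
Qed.

(** * Regular sequences *)

(** An ideal maximal among the counterexamples would satisfy the premise of the induction step. *)
Lemma noetherian_ind (Q : (R -> Prop) -> Prop) :
  (forall J, is_ideal J ->
     (forall J', is_ideal J' -> (forall f, J f -> J' f) -> (exists f, J' f /\ ~ J f) -> Q J') ->
   Q J) ->
  forall J, is_ideal J -> Q J.
Proof.
move=> H J idJ; apply: NNPP => nQJ.
have [||M [idM nQM] maxM] := @noetherian (fun J => is_ideal J /\ ~ Q J).
- by move=> A [].
- by exists J.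
apply: nQM; apply: H => // J' idJ' MJ' [f [J'f nMf]]; apply: NNPP => nQJ'.
by apply: nMf; apply: maxM J'f.
Qed.

Definition colon J u : R -> Prop := fun a => J (a * u).

Lemma colon_ideal J u : is_ideal J -> is_ideal (colon J u).
Proof.
move=> idJ; split=> [|a b|r a]; rewrite /colon.
- by rewrite mul0r; exact: ideal0.
- by rewrite mulrDl; exact: idealD.
- by rewrite -mulrA; exact: ideal_mull.
Qed.

(** A maximal element among the ideals J : u with u outside J is prime: if it contains ab but not b,
    then J : bu is in the family and contains J : u, so the two agree, and a lies in J : bu. *)
Lemma exists_prime_colon J : is_ideal J -> ~ J 1 ->
  exists2 u, ~ J u & is_prime_ideal (colon J u).
Proof.
move=> idJ nJ1.
have [||_ [u nJu ->] maxu] := @noetherian (fun A => exists2 u, ~ J u & A = colon J u).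
- by move=> _ [u _ ->]; exact: colon_ideal.
- by exists (colon J 1), 1.
exists u => //; split; [exact: colon_ideal | by rewrite /colon mul1r |] => a b Jab.
case: (classic (J (b * u))) => [|nJbu]; [by right | left].
apply: (maxu (colon J (b * u))); first by exists (b * u).
- by rewrite /colon => f; rewrite mulrCA; exact: ideal_mull.
- by rewrite /colon mulrA.
Qed.

Definition nonzerodivisor J f := forall g, J (f * g) -> J g.

(** This is Hom(k, R/J) = 0, where k is the quotient of R by the variables. *)
Definition zero_socle J := forall g, (forall i, J ('X_i * g)) -> J g.

Lemma mdegS_split N (m : 'X_{1..n}) : mdeg m = N.+1 ->
  exists i m', m = (U_(i) + m')%MM /\ mdeg m' = N.
Proof.
move=> dm; have [i mi] : exists i, m i != 0%N.
  apply/existsP; rewrite -negb_forall; apply/negP => /forallP m0.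
  by move: dm; rewrite mdegE big1 // => i _; apply/eqP/m0.
have E : m = (U_(i) + (m - U_(i)))%MM by rewrite addmC submK // lep1mP.
exists i, (m - U_(i))%MM; split=> //.
by move: dm; rewrite {1}E mdegD mdeg1 add1n => -[].
Qed.

(* Take [u] with [J : u] prime.  Outside that prime and the primes found for
   J + (u), one has [f g \in J] only if some power of the maximal ideal sends
   [g] into J; if [J : u] contains the maximal ideal, one more multiplication
   by a variable replaces avoiding it. *)
Lemma zero_divisor_primes J : is_ideal J ->
  exists L : seq (R -> Prop),
    (forall P, List.In P L -> is_prime_ideal P /\ exists i, ~ P 'X_i) /\
    (forall f, (forall P, List.In P L -> ~ P f) -> forall g, J (f * g) ->
       exists N, forall m, mdeg m = N -> J ('X_[m] * g)).
Proof.
move: J; apply: noetherian_ind => J idJ IH.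
case: (classic (J 1)) => [J1|nJ1].
  exists [::]; split=> // f _ g _; exists 0%N => m _.
  by rewrite -[_ * g]mulr1; exact: ideal_mull.
have [u nJu prP] := exists_prime_colon idJ nJ1.
have idJu := adjoin_ideal u idJ.
have [|||L [primeL Lsat]] := IH (adjoin J u); first by [].
- by move=> f; exact: adjoin_sub.
- by exists u; split; first exact: adjoin_gen.
case: (classic (exists i, ~ colon J u 'X_i)) => [[i Pi]|mP].
  exists (colon J u :: L).
  split=> [P [<-|]|f fL g Jfg]; [by split; last by exists i | exact: primeL |].
  have [|N HN] := Lsat f _ g (adjoin_sub _ Jfg).
    by move=> P PL; apply: fL; right.
  exists N => m /HN[a Ha].
  have Jfau : colon J u (f * a).
    rewrite /colon; apply/(ideal_subr idJ (g := 'X_[m] * (f * g))); last exact: ideal_mull.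
    have -> : f * a * u - 'X_[m] * (f * g) = - (f * ('X_[m] * g - a * u)) by ring.
    by apply: idealN => //; exact: ideal_mull.
  apply/(ideal_subr idJ Ha).
  have [_ _ /(_ _ _ Jfau)[Pf|//]] := prP.
  by case: (fL (colon J u)) => //; left.
exists L; split=> // f fL g Jfg.
have [|N HN] := Lsat f _ g (adjoin_sub _ Jfg); first exact: fL.
exists N.+1 => m /mdegS_split[i [m' [-> /HN[a Ha]]]].
rewrite mpolyXD -mulrA.
apply/(ideal_subr idJ (g := a * ('X_i * u))).
  have -> : 'X_i * ('X_[m'] * g) - a * ('X_i * u) = 'X_i * ('X_[m'] * g - a * u) by ring.
  exact: ideal_mull.
by apply: ideal_mull => //; apply: NNPP => nP; apply: mP; exists i.
Qed.

(** Lower N one step at a time: a multiple of [g] by a monomial of degree N - 1 is sent into J by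
    every variable, hence lies in J. *)
Lemma zero_socle_saturated J N g : is_ideal J -> zero_socle J ->
  (forall m, mdeg m = N -> J ('X_[m] * g)) -> J g.
Proof.
move=> idJ socJ; elim: N g => [|N IH] g H.
  by have := H 0%MM; rewrite mdeg0 mpolyX0 mul1r; apply.
apply: IH => m dm; apply: socJ => i.
by rewrite mulrA -mpolyXD; apply: H; rewrite mdegD mdeg1 dm.
Qed.

(** * Prime avoidance and common regular elements *)

Lemma max_ideal_ideal : is_ideal (@max_ideal k n).
Proof. exact: ideal_gen_is_ideal. Qed.

Lemma max_idealX i : max_ideal ('X_i : R).
Proof. by apply: ideal_gen_sub; exists i. Qed.

(** As a combination of the variables, [f] sends into J whatever all of them send into J. *)
Lemma nonzerodivisor_zero_socle J f : is_ideal J -> max_ideal f ->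
  nonzerodivisor J f -> zero_socle J.
Proof.
move=> idJ mf regf g Hg; apply: regf; move: f mf; apply: ideal_ind.
  split=> [|a b|r a]; [by rewrite mul0r; exact: ideal0 | by rewrite mulrDl; exact: idealD |].
  by rewrite -mulrA; exact: ideal_mull.
by move=> _ [i ->].
Qed.

(** By induction on the list: if the element [a] avoiding L lies in the new prime P, correct it by a
    multiple of a variable outside P. The correction must leave P but stay in each Q of L that is
    not inside P; a Q inside P is avoided along with P. *)
Lemma prime_avoidance (L : seq (R -> Prop)) :
  (forall P, List.In P L -> is_prime_ideal P /\ exists i, ~ P 'X_i) ->
  exists2 h, max_ideal h & forall P, List.In P L -> ~ P h.
Proof.
elim: L => [|P L IH] HL; first by exists 0 => //; exact: (ideal0 max_ideal_ideal).
have [|a ma aL] := IH; first by move=> Q QL; apply: HL; right.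
have [[idP nP1 primeP] [i nPi]] : is_prime_ideal P /\ exists i, ~ P 'X_i by apply: HL; left.
case: (classic (P a)) => [Pa|nPa]; last by exists a => // Q [<-|/aL].
(* [b] is a product of elements of Q outside P, one for each Q in L not contained in P. *)
have [b nPb bL] : exists2 b, ~ P b &
    forall Q, List.In Q L -> (forall f, Q f -> P f) \/ Q b.
  have {HL} : forall Q, List.In Q L -> is_ideal Q.
    by move=> Q QL; case: (HL Q) => [|[]]; first by right.
  elim: L {IH aL} => [|Q L IH] HL; first by exists 1.
  have [|b nPb bL] := IH; first by move=> Q' QL; apply: HL; right.
  have idQ : is_ideal Q by apply: HL; left.
  case: (classic (exists2 c, Q c & ~ P c)) => [[c Qc nPc]|QP]; last first.
    exists b => // Q' [<-|/bL//]; left=> f Qf; apply: NNPP => nPf; apply: QP; by exists f.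
  exists (c * b); first by case/primeP.
  move=> Q' [<-|Q'L]; first by right; exact: ideal_mulr.
  case: (bL _ Q'L); first by left.
  by right; apply: ideal_mull => //; apply: HL; right.
have nPXb : ~ P ('X_i * b) by case/primeP.
exists (a + 'X_i * b).
  apply: (idealD max_ideal_ideal) => //; apply: (ideal_mulr max_ideal_ideal).
  exact: max_idealX.
have nPh : ~ P (a + 'X_i * b).
  move=> Ph; apply: nPXb; have -> : 'X_i * b = (a + 'X_i * b) - a by ring.
  exact: idealB.
move=> Q [<-//|QL] Qh; case: (bL _ QL) => [QP|Qb]; first exact/nPh/QP.
have [[idQ _ _] _] : is_prime_ideal Q /\ exists i, ~ Q 'X_i by apply: HL; right.
apply: (aL Q QL); have -> : a = (a + 'X_i * b) - 'X_i * b by ring.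
by apply: idealB => //; exact: ideal_mull.
Qed.

(** Avoid the preimages under [phi] of the primes from [zero_divisor_primes]. A preimage misses the
    same variable as its prime, since [phi] raises variables to a power. *)
Lemma exists_nonzerodivisor (phi : {rmorphism R -> R}) (Js : seq (R -> Prop)) (e : nat) :
  (forall i, phi 'X_i = 'X_i ^+ e) ->
  (forall J, List.In J Js -> is_ideal J /\ zero_socle J) ->
  exists2 h, max_ideal h & forall J, List.In J Js -> nonzerodivisor J (phi h).
Proof.
move=> phiX HJs.
have [L [primeL LJs]] : exists L : seq (R -> Prop),
    (forall P, List.In P L -> is_prime_ideal P /\ exists i, ~ P 'X_i) /\
    forall f, (forall P, List.In P L -> ~ P f) ->
      forall J, List.In J Js -> nonzerodivisor J f.
  elim: Js HJs => [|J Js IH] HJs; first by exists [::].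
  have [|L [primeL LJs]] := IH; first by move=> J' J'Js; apply: HJs; right.
  have [idJ socJ] : is_ideal J /\ zero_socle J by apply: HJs; left.
  have [M [primeM MJ]] := zero_divisor_primes idJ.
  exists (M ++ L)%list; split=> [P PML|f fLM J' [<-|J'Js]].
    by case: (List.in_app_or _ _ _ PML); [exact: primeM | exact: primeL].
    move=> g Jfg; have [|N] := MJ f _ g Jfg; last exact: zero_socle_saturated.
    by move=> P PM; apply: fLM; apply: List.in_or_app; left.
  by apply: LJs => // P PL; apply: fLM; apply: List.in_or_app; right.
have [|h mh Hh] := @prime_avoidance (List.map (fun P f => P (phi f)) L).
  move=> Q QL; have [P [<- PL]] := proj1 (List.in_map_iff _ _ _) QL.
  have [[idP nP1 primeP] [i nPi]] := primeL P PL; split.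
    split=> [||a b].
    - split=> [|a b|r a]; rewrite ?(rmorph0, rmorphD, rmorphM).
      + exact: ideal0.
      + exact: idealD.
      + exact: ideal_mull.
    - by rewrite rmorph1.
    - by rewrite rmorphM; exact: primeP.
  exists i; rewrite phiX; elim: e {phiX} => [|e IH] //; by rewrite exprS => /primeP[].
exists h => // J JJs; apply: LJs => // P PL.
exact: (Hh (fun f => P (phi f))) (List.in_map (fun P f => P (phi f)) _ _ PL).
Qed.

(** Regularity in the weak sense: the final quotient may vanish. Properness is restored by
    [ideal_add_proper]. *)
Fixpoint has_regular_seq J d : Prop :=
  if d is d'.+1 then
    exists f, [/\ max_ideal f, nonzerodivisor J f & has_regular_seq (adjoin J f) d']
  else True.

(** If f u = v g modulo J, regularity of [g] modulo [f] gives v = w f modulo J, and [f] cancels. *)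
Lemma nonzerodivisor_swap J f g : is_ideal J ->
  nonzerodivisor J f -> nonzerodivisor (adjoin J f) g -> nonzerodivisor (adjoin J g) f.
Proof.
move=> idJ regf regg u [v Hv].
have [|w Hw] := regg v.
  exists u; have -> : g * v - u * f = - (f * u - v * g) by ring.
  exact: idealN.
exists w; apply: regf.
have -> : f * (u - w * g) = (f * u - v * g) + g * (v - w * f) by ring.
by apply: idealD => //; exact: ideal_mull.
Qed.

(* The socles Hom(k, M/fM) and Hom(k, M/gM) are both Ext^1(k, M)
   for M = R/J. *)
Lemma zero_socle_exchange J f g : is_ideal J -> max_ideal f -> max_ideal g ->
  nonzerodivisor J f -> nonzerodivisor J g ->
  zero_socle (adjoin J f) -> zero_socle (adjoin J g).
Proof.
move=> idJ mf mg regf regg socf u Hu.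
(* The class of [v] modulo J + (f) is the image of [u] in the other socle. *)
have [v Hv] : adjoin J g (f * u).
  have idg := adjoin_ideal g idJ.
  move: f mf {regf socf}; apply: ideal_ind => [|_ [i ->]//].
  split=> [|a b|r a]; [by rewrite mul0r; exact: ideal0 | by rewrite mulrDl; exact: idealD |].
  by rewrite -mulrA; exact: ideal_mull.
have [i|w Hw] := socf v.
  have [w Hw] := Hu i; exists w; apply: regg.
  have -> : g * ('X_i * v - w * f) = f * ('X_i * u - w * g) - 'X_i * (f * u - v * g) by ring.
  by apply: idealB => //; exact: ideal_mull.
exists w; apply: regf.
have -> : f * (u - w * g) = (f * u - v * g) + g * (v - w * f) by ring.
by apply: idealD => //; exact: ideal_mull.
Qed.

Lemma has_regular_seq_zero_socle J d : is_ideal J -> has_regular_seq J d.+1 -> zero_socle J.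
Proof. by move=> idJ [f [mf regf _]]; exact: nonzerodivisor_zero_socle mf regf. Qed.

(** Since [f] and [g] may fail to be regular modulo each other, an element [h] regular modulo J, J +
    (f) and J + (g) links them. Induction over J + (f) with [h] gives a sequence modulo J + (h)
    starting with [f]; induction over J + (h) then trades [f] for [g]. *)
Lemma has_regular_seq_adjoin d J g : is_ideal J -> has_regular_seq J d.+1 ->
  max_ideal g -> nonzerodivisor J g -> has_regular_seq (adjoin J g) d.
Proof.
elim: d J g => [//|d IH] J g idJ [f [mf regf seqf]] mg regg.
have idf := adjoin_ideal f idJ; have idg := adjoin_ideal g idJ.
have socf := has_regular_seq_zero_socle idf seqf.
have socg := zero_socle_exchange idJ mf mg regf regg socf.
have [||h mh Hh] := @exists_nonzerodivisor idfun [:: J; adjoin J f; adjoin J g] 1.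
- by [].
- move=> A /= [<-|[<-|[<-|//]]]; split=> //; exact: nonzerodivisor_zero_socle mf regf.
have regh : nonzerodivisor J h by apply: Hh; left.
have reghf : nonzerodivisor (adjoin J f) h by apply: Hh; right; left.
have reghg : nonzerodivisor (adjoin J g) h by apply: Hh; right; right; left.
exists h; split=> //; rewrite adjoinAC; apply: (IH (adjoin J h) g) => //; first exact: adjoin_ideal.
  exists f; split=> //; first exact: nonzerodivisor_swap.
  by rewrite adjoinAC; exact: IH.
exact: nonzerodivisor_swap.
Qed.

(* The hypotheses exhibit R/J' as a direct summand of R/J, viewed as a module
   through [phi]. *)
Lemma has_regular_seq_retract (phi : {rmorphism R -> R}) (rho : {additive R -> R}) (e : nat) :
  (forall i, phi 'X_i = 'X_i ^+ e.+1) ->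
  (forall a b, rho (phi a * b) = a * rho b) -> rho 1 = 1 ->
  forall d J J', is_ideal J -> is_ideal J' ->
    (forall f, J' f -> J (phi f)) -> (forall f, J f -> J' (rho f)) ->
  has_regular_seq J d -> has_regular_seq J' d.
Proof.
move=> phiX rhoM rho1; elim=> [//|d IH] J J' idJ idJ' phiJ rhoJ seqJ.
have socJ := has_regular_seq_zero_socle idJ seqJ.
have [|h mh Hh] := @exists_nonzerodivisor phi [:: J] e.+1 phiX.
  by move=> A [<-|//].
have regh : nonzerodivisor J (phi h) by apply: Hh; left.
have mphih : max_ideal (phi h).
  move: h mh {Hh regh}; apply: ideal_ind => [|_ [i ->]].
    split=> [|a b|r a]; rewrite ?(rmorph0, rmorphD, rmorphM).
    - exact: ideal0 max_ideal_ideal.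
    - exact: idealD max_ideal_ideal _ _.
    - exact: ideal_mull max_ideal_ideal _ _.
  by rewrite phiX exprS; apply: (ideal_mulr max_ideal_ideal); exact: max_idealX.
exists h; split=> // [g J'hg|].
  have -> : g = rho (phi g) by rewrite -[phi g]mulr1 rhoM rho1 mulr1.
  by apply/rhoJ/regh; rewrite -rmorphM; exact: phiJ.
(* The retraction passes to the quotients by [phi h] and [h], because [rho] is linear along
   [phi]. *)
apply: (IH (adjoin J (phi h))); try exact: adjoin_ideal.
- by move=> f [a /phiJ]; rewrite rmorphB rmorphM => Ha; exists (phi a).
- by move=> f [a /rhoJ]; rewrite raddfB mulrC rhoM mulrC => Ha; exists (rho a).
- exact: has_regular_seq_adjoin.
Qed.

(** * Symbolic powers of squarefree monomial ideals *)

Section VarPrime.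
Variable F : {set 'I_n}.
Implicit Types m : 'X_{1..n}.

Definition wt m := (\sum_(i in F) m i)%N.

Lemma wtD m1 m2 : wt (m1 + m2) = (wt m1 + wt m2)%N.
Proof. by rewrite /wt -big_split /=; apply: eq_bigr => i _; rewrite mnmDE. Qed.

Lemma wt1 i : wt U_(i) = (i \in F).
Proof.
rewrite /wt; case: (boolP (i \in F)) => iF.
  rewrite (bigD1 i) //= mnm1E eqxx big1 // => j /andP[_ /negPf ji].
  by rewrite mnm1E eq_sym ji.
rewrite big1 // => j jF; rewrite mnm1E; case: eqVneq => // ij.
by rewrite ij jF in iF.
Qed.

Lemma wt_gt0P m : reflect (exists i m', i \in F /\ m = (U_(i) + m')%MM) (0 < wt m)%N.
Proof.
rewrite lt0n /wt; apply: (iffP idP) => [|[i [m' [iF ->]]]]; last first.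
  by rewrite (bigD1 i) //= mnmDE mnm1E eqxx.
rewrite sum_nat_eq0 => /forall_inPn[i iF mi].
by exists i, (m - U_(i))%MM; split=> //; rewrite addmC submK // lep1mP.
Qed.

(* Locked because unification would otherwise unfold the sums defining [mmap]. *)
Definition homogenize : R -> {poly R} :=
  locked (mmap (polyC \o @mpolyC n k) (fun i => ('X_i)%:P * 'X^(i \in F))).

Lemma homogenizeE :
  homogenize = mmap (polyC \o @mpolyC n k) (fun i => ('X_i)%:P * 'X^(i \in F)).
Proof. by rewrite /homogenize -lock. Qed.

Lemma homogenizeX m : homogenize 'X_[m] = ('X_[m])%:P * 'X^(wt m).
Proof.
have -> : 'X^(wt m) = \prod_i 'X^(i \in F) ^+ m i :> {poly R}.
  rewrite /wt -prodrXr big_mkcond; apply: eq_bigr => i _.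
  by case: ifP; rewrite ?expr1 // expr0 expr1n.
rewrite homogenizeE mmapX /mmap1 mpolyXE_id rmorph_prod /=.
by rewrite -big_split /=; apply: eq_bigr => i _; rewrite exprMn rmorphXn.
Qed.

Lemma homogenizeD f g : homogenize (f + g) = homogenize f + homogenize g.
Proof. by rewrite homogenizeE; exact: mmapD. Qed.

Lemma homogenizeM f g : homogenize (f * g) = homogenize f * homogenize g.
Proof. by rewrite homogenizeE; exact: rmorphM. Qed.

(** By linearity this is a statement about monomials, where the new indeterminate records the degree
    in the variables of F. *)
Lemma mcoeff_coef_homogenize f d m :
  ((homogenize f)`_d)@_m = f@_m *+ (wt m == d).
Proof.
elim/mpolyind: f => [|c m' p _ _ IH].
  by rewrite homogenizeE mmap0 coef0 !mcoeff0 mul0rn.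
rewrite homogenizeD coefD.
rewrite mcoeffD IH (mcoeffD m (c *: 'X_[m'])) mulrnDl; congr (_ + _).
have -> : homogenize (c *: 'X_[m']) = c%:MP%:P * homogenize 'X_[m'].
  by rewrite homogenizeE; exact: mmapZ.
rewrite homogenizeX !coefCM coefXn mcoeffCM mcoeffZ -mulrnAr; congr (_ * _).
rewrite mulr_natr mcoeffMn mcoeffX.
by case: (m' =P m) => [->|_]; rewrite ?mul0rn // eq_sym.
Qed.

(* The t-th symbolic power of the prime generated by the x_i, i \in F. *)
Definition wt_ideal t f : Prop := forall d, (d < t)%N -> (homogenize f)`_d = 0.

Lemma wt_idealP t f : wt_ideal t f <-> forall m, m \in msupp f -> (t <= wt m)%N.
Proof.
split=> [H m|H d dt].
  rewrite mcoeff_msupp leqNgt; apply: contra => mt.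
  by have := mcoeff_coef_homogenize f (wt m) m; rewrite H // mcoeff0 eqxx mulr1n => <-.
apply/mpolyP => m; rewrite mcoeff0 mcoeff_coef_homogenize.
case: eqP => [md|]; last by rewrite mulr0n.
case: (boolP (m \in msupp f)) => [/H|/memN_msupp_eq0->]; last by rewrite mul0rn.
by rewrite md leqNgt dt.
Qed.

Lemma wt_idealX t m : wt_ideal t 'X_[m] <-> (t <= wt m)%N.
Proof.
rewrite wt_idealP msuppX; split; first by apply; rewrite inE.
by move=> H m'; rewrite inE => /eqP->.
Qed.

(** In the convolution for a coefficient of index below s + t, each term has its first index below
    [s] or its second below [t]. *)
Lemma wt_ideal_mul s t f g : wt_ideal s f -> wt_ideal t g -> wt_ideal (s + t) (f * g).
Proof.
move=> Hf Hg d dst; rewrite homogenizeM coefM big1 // => i _.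
case: (ltnP i s) => [/Hf->|si]; first by rewrite mul0r.
rewrite Hg ?mulr0 //; have := ltn_ord i; rewrite ltnS => id.
by rewrite ltn_subLR // (leq_trans dst) // leq_add2r.
Qed.

Lemma wt_ideal_is_ideal t : is_ideal (wt_ideal t).
Proof.
split=> [d dt|a b Ha Hb d dt|r a Ha].
- by rewrite homogenizeE mmap0 coef0.
- by rewrite homogenizeD coefD Ha // Hb // addr0.
- by rewrite -(add0n t); apply: wt_ideal_mul.
Qed.

(** Membership means that the constant coefficient of [homogenize] vanishes, and that coefficient is
    multiplicative with values in a domain. *)
Lemma wt_ideal_prime : is_prime_ideal (wt_ideal 1).
Proof.
split=> [||a b]; first exact: wt_ideal_is_ideal.
  by rewrite -mpolyX0 wt_idealX /wt big1 // => i _; rewrite mnm0E.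
move=> /(_ 0%N isT)/eqP; rewrite homogenizeM coef0M mulf_eq0.
by case/orP => /eqP H; [left|right] => -[].
Qed.

(** Powers of a prime generated by variables are primary: once the lower coefficients of [f] vanish,
    coefficient d of the product is the nonzero constant coefficient of [u] times coefficient d of
    [f]. *)
Lemma wt_ideal_cancel t u f : ~ wt_ideal 1 u -> wt_ideal t (u * f) -> wt_ideal t f.
Proof.
move=> nu Huf d; elim/ltn_ind: d => d IH dt.
have u0 : (homogenize u)`_0 != 0 by apply/eqP => u0; apply: nu => -[].
have := Huf d dt; rewrite homogenizeM coefM big_ord_recl subn0 big1 ?addr0 => [|i _].
  by move/eqP; rewrite mulf_eq0 (negPf u0) => /eqP.
rewrite IH ?mulr0 //; have := ltn_ord i; rewrite /= /bump add1n => id.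
  by rewrite ltn_subrL (leq_ltn_trans _ id).
exact: leq_ltn_trans (leq_subr _ _) dt.
Qed.

End VarPrime.

Lemma wt_ideal_subset (F F' : {set 'I_n}) t f : F \subset F' ->
  wt_ideal F t f -> wt_ideal F' t f.
Proof.
move=> FF' /wt_idealP H; apply/wt_idealP => m /H tm.
apply: (leq_trans tm); rewrite /wt [X in (_ <= X)%N](big_setID F) /= (setIidPr FF').
exact: leq_addr.
Qed.

Lemma prime_ideal_monomial P m : is_prime_ideal P -> P 'X_[m] ->
  exists2 i, m i != 0%N & P 'X_i.
Proof.
case=> idP nP1 primeP; move dm: (mdeg m) => d; elim: d m dm => [|d IH] m dm.
  by move/eqP: dm; rewrite mdeg_eq0 => /eqP->; rewrite mpolyX0.
have [i [m' [-> /IH Hm']]] := mdegS_split dm; rewrite mpolyXD => /primeP[PXi|/Hm'[j m'j PXj]].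
  by exists i; rewrite // mnmDE mnm1E eqxx.
by exists j; rewrite // mnmDE addn_eq0 negb_and m'j orbT.
Qed.

Lemma pow_ideal_ideal I t : is_ideal (pow_ideal I t : R -> Prop).
Proof. exact: ideal_gen_is_ideal. Qed.

Lemma pow_idealS I t f g : I f -> pow_ideal I t g -> pow_ideal I t.+1 (f * g).
Proof.
move=> If; move: g; apply: ideal_ind => [|_ [s [<- sI ->]]].
  have idp := pow_ideal_ideal I t.+1.
  split=> [|a b|r a]; first by rewrite mulr0; exact: (ideal0 idp).
    by rewrite mulrDr; exact: (idealD idp).
  by rewrite mulrCA; exact: (ideal_mull idp).
apply: ideal_gen_sub; exists (f :: s); split=> //; last by rewrite big_cons.
by move=> g; rewrite in_cons => /predU1P[->|/sI].
Qed.

Lemma pow_ideal_wt (I : R -> Prop) F t f : (forall g, I g -> wt_ideal F 1 g) ->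
  pow_ideal I t f -> wt_ideal F t f.
Proof.
move=> IF; move: f; apply: ideal_ind => [|_ [s [<- sI ->]]].
  exact: wt_ideal_is_ideal.
elim: s sI => [|g s IH] sI; first by case.
rewrite big_cons /= -add1n; apply: wt_ideal_mul.
  by apply/IF/sI; rewrite mem_head.
by apply: IH => h hs; apply: sI; rewrite in_cons hs orbT.
Qed.

Lemma symb_pow_is_ideal I t : is_ideal (symb_pow I t : R -> Prop).
Proof.
have idp := pow_ideal_ideal I t.
split=> [P [[_ nP1 _] _ _]|a b Ha Hb P minP|r a Ha P minP].
- by exists 1; split=> //; rewrite mulr0; exact: (ideal0 idp).
- have [u [nPu Hu]] := Ha P minP; have [v [nPv Hv]] := Hb P minP.
  exists (u * v); split; first by case: minP => -[_ _ H] _ _ /H[].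
  have -> : u * v * (a + b) = v * (u * a) + u * (v * b) by ring.
  by apply: (idealD idp) => //; exact: (ideal_mull idp).
- have [u [nPu Hu]] := Ha P minP; exists u; split=> //.
  by rewrite mulrCA; exact: (ideal_mull idp).
Qed.

(** * Minimal primes and monomials of symbolic powers *)

Section SquarefreeMonomial.
Variables (I : R -> Prop) (sqfI : sqfree_monomial_ideal I).

(** The variables in P generate a prime inside P. It contains I, because each generating monomial
    lies in P and so has a variable in P; minimality gives equality. *)
Lemma minimal_prime_wt_ideal P : is_minimal_prime I P -> exists F, P = wt_ideal F 1.
Proof.
have [S [Ssqf IS]] := sqfI.
move=> [prP IP minP]; have [idP _ _] := prP.
pose F := [set i : 'I_n | is_left (excluded_middle_informative (P 'X_i))].
have inF i : (i \in F) <-> P 'X_i.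
  by rewrite inE; case: excluded_middle_informative.
have FP f : wt_ideal F 1 f -> P f.
  move=> /wt_idealP H; rewrite [f]mpolyE; apply: ideal_sum => // m /H/wt_gt0P[i [m' [iF ->]]].
  by apply: idealZ => //; rewrite mpolyXD; apply: ideal_mulr => //; exact/inF.
exists F; apply: pred_ext => f; split; last exact: FP.
apply: minP => //; first exact: wt_ideal_prime.
move=> g /IS; apply: ideal_ind; first exact: wt_ideal_is_ideal.
move=> _ [m [Sm ->]].
have /(prime_ideal_monomial prP)[i mi /inF iF] : P 'X_[m].
  by apply/IP/IS; apply: ideal_gen_sub; exists m.
rewrite wt_idealX; apply/wt_gt0P; exists i, (m - U_(i))%MM; split=> //.
by rewrite addmC submK // lep1mP.
Qed.

(** I and its minimal prime agree after localization. Some generator involves no variable of F other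
    than [i], and being squarefree it is ['X_i] times a monomial outside the prime. *)
Lemma minimal_prime_var F i : is_minimal_prime I (wt_ideal F 1) -> i \in F ->
  exists u, ~ wt_ideal F 1 u /\ I (u * 'X_i).
Proof.
have [S [Ssqf IS]] := sqfI.
move=> [prF IF minF] iF; have [idF _ _] := prF.
have SI m : S m -> I 'X_[m] by move=> Sm; apply/IS; apply: ideal_gen_sub; exists m.
(* Otherwise the smaller prime generated by F without [i] would contain I. *)
have [m Sm wtm] : exists2 m, S m & wt (F :\ i) m = 0%N.
  apply: NNPP => H; suff /wt_idealX: wt_ideal (F :\ i) 1 ('X_i : R).
    by rewrite wt1 !inE eqxx.
  apply: minF; first exact: wt_ideal_prime.
  - move=> f /IS; apply: ideal_ind; first exact: wt_ideal_is_ideal.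
    move=> _ [m [Sm ->]]; apply/wt_idealX; rewrite lt0n; apply/eqP => wtm.
    by apply: H; exists m.
  - by move=> f; apply: wt_ideal_subset; exact: subD1set.
  - by apply/wt_idealX; rewrite wt1 iF.
have wtF : wt F m = m i.
  by rewrite /wt (big_setD1 i) //= -[X in (_ + X)%N]/(wt (F :\ i) m) wtm addn0.
have mi : m i = 1%N.
  apply/eqP; rewrite eqn_leq Ssqf //= -wtF; exact/wt_idealX/IF/SI.
have Em : m = (U_(i) + (m - U_(i)))%MM by rewrite addmC submK // lep1mP mi.
exists 'X_[m - U_(i)]; split; last by rewrite -mpolyXD addmC -Em; exact: SI.
rewrite wt_idealX; move: wtF; rewrite {1}Em wtD wt1 iF mi add1n => -[->].
by [].
Qed.

Lemma symb_pow_wt t f F m : symb_pow I t f -> is_minimal_prime I (wt_ideal F 1) ->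
  m \in msupp f -> (t <= wt F m)%N.
Proof.
move=> Hf minF; have [u [nFu Hu]] := Hf _ minF; move: m; apply/wt_idealP.
by apply: wt_ideal_cancel nFu _; apply: pow_ideal_wt Hu; case: minF.
Qed.

(** Each factor of [m] that is a variable of F lies in I locally at the prime; peel off [t] of them
    and multiply the multipliers. *)
Lemma symb_powX t m :
  (forall F, is_minimal_prime I (wt_ideal F 1) -> (t <= wt F m)%N) -> symb_pow I t 'X_[m].
Proof.
move=> Hm P minP; have [F EF] := minimal_prime_wt_ideal minP; subst P.
move: (Hm F minP) => {Hm}; elim: t m => [|t IH] m tm.
  exists 1; split; first by case: minP => -[].
  rewrite mul1r -['X_[m]]mulr1; apply: (ideal_mull (pow_ideal_ideal I 0)).
  by apply: ideal_gen_sub; exists [::]; split; rewrite ?big_nil.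
have /wt_gt0P[i [m' [iF Em]]] : (0 < wt F m)%N by exact: leq_trans tm.
have [|v [nFv Hv]] := IH m'; first by move: tm; rewrite Em wtD wt1 iF.
have [u [nFu Hu]] := minimal_prime_var minP iF.
exists (u * v); split; first by case: (wt_ideal_prime F) => _ _ H /H[].
rewrite Em mpolyXD; have -> : u * v * ('X_i * 'X_[m']) = (u * 'X_i) * (v * 'X_[m']) by ring.
exact: pow_idealS.
Qed.

(** Any minimal prime rules out a constant term, by [symb_pow_wt]; without minimal primes the
    symbolic power would contain 1. *)
Lemma symb_pow_constant t f : (0 < t)%N -> ~ symb_pow I t 1 -> symb_pow I t f -> f@_0%MM = 0.
Proof.
move=> t0 n1 Hf; apply: memN_msupp_eq0; apply/negP => f0; apply: n1 => P minP.
have [F EF] := minimal_prime_wt_ideal minP; subst P.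
have := symb_pow_wt Hf minP f0; rewrite /wt big1 ?leqn0 => [|i _]; last by rewrite mnm0E.
by case: t t0 {Hf}.
Qed.

End SquarefreeMonomial.

(** * The endomorphism x_j -> x_j^e and its retraction *)

Definition dilate (e : nat) : R -> R := comp_mpoly [tuple 'X_i ^+ e | i < n].

HB.instance Definition _ e := GRing.RMorphism.copy (dilate e)
  (comp_mpoly [tuple 'X_i ^+ e | i < n]).

Lemma dilateXU e i : dilate e 'X_i = 'X_i ^+ e.
Proof. by rewrite /dilate comp_mpolyXU -tnth_nth tnth_mktuple. Qed.

Lemma dilateX e m : dilate e 'X_[m] = 'X_[m *+ e].
Proof.
rewrite /dilate comp_mpolyX mpolyXE_id; apply: eq_bigr => i _.
by rewrite tnth_mktuple mulmnE mulnC exprM.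
Qed.

Definition contract_mon e (m : 'X_{1..n}) : R :=
  if [forall i, e %| m i]%N then 'X_[[multinom (m i %/ e)%N | i < n]] else 0.

Definition contract e (f : R) : R := \sum_(m <- msupp f) f@_m *: contract_mon e m.

(** A common degree bound allows polynomials with different supports to be summed over one index
    type. *)
Lemma contractE e b f : (msize f <= b)%N ->
  contract e f = \sum_(m : 'X_{1..n < b}) f@_m *: contract_mon e m.
Proof.
move=> fb; rewrite /contract (big_mksub 'X_{1..n < b}) ?msupp_uniq //=; first last.
  by move=> m /msize_mdeg_lt /leq_trans; apply.
by rewrite big_rmcond //= => m /memN_msupp_eq0 ->; rewrite scale0r.
Qed.

Lemma contract_is_additive e : additive (contract e).
Proof.
move=> f g; pose b := maxn (msize (f - g)) (maxn (msize f) (msize g)).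
rewrite !(@contractE e b) ?leq_max ?leqnn ?orbT // -sumrB; apply: eq_bigr => m _.
by rewrite mcoeffB scalerBl.
Qed.

HB.instance Definition _ e := GRing.isAdditive.Build R R (contract e) (contract_is_additive e).

Lemma contractZ e c f : contract e (c *: f) = c *: contract e f.
Proof.
rewrite !(@contractE e (maxn (msize (c *: f)) (msize f))) ?leq_max ?leqnn ?orbT //.
by rewrite scaler_sumr; apply: eq_bigr => m _; rewrite mcoeffZ scalerA.
Qed.

Lemma contractX e m : contract e 'X_[m] = contract_mon e m.
Proof. by rewrite /contract msuppX big_seq1 mcoeffX eqxx scale1r. Qed.

Lemma contract_monMn e m m' : (0 < e)%N ->
  contract_mon e (m *+ e + m')%MM = 'X_[m] * contract_mon e m'.
Proof.
move=> e0; rewrite /contract_mon.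
have -> : [forall i, e %| (m *+ e + m')%MM i]%N = [forall i, e %| m' i]%N.
  by apply: eq_forallb => i; rewrite mnmDE mulmnE dvdn_addr // dvdn_mull.
case: ifP => _; last by rewrite mulr0.
rewrite -mpolyXD; congr 'X_[_]; apply/mnmP => i.
by rewrite mnmDE !mnmE mulmnE divnMDl.
Qed.

(** Both sides are bilinear; on monomials, adding a multiple of [e] to the exponents does not affect
    divisibility by [e]. *)
Lemma contract_dilate e a b : (0 < e)%N -> contract e (dilate e a * b) = a * contract e b.
Proof.
move=> e0; rewrite [a]mpolyE rmorph_sum /= !mulr_suml raddf_sum /=; apply: eq_bigr => m _.
rewrite /dilate comp_mpolyZ -/(dilate e _) dilateX -!scalerAl contractZ; congr (_ *: _).
rewrite [b]mpolyE mulr_sumr !raddf_sum mulr_sumr /=; apply: eq_bigr => m' _.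
by rewrite -scalerAr !contractZ -mpolyXD !contractX contract_monMn // scalerAr.
Qed.

Lemma contract1 e : contract e 1 = 1.
Proof.
rewrite -mpolyX0 contractX /contract_mon.
have -> : [forall i, e %| (0%MM : 'X_{1..n}) i]%N by apply/forallP => i; rewrite mnm0E dvdn0.
by congr 'X_[_]; apply/mnmP => i; rewrite mnmE mnm0E div0n.
Qed.

Lemma wtMn (F : {set 'I_n}) m e : wt F (m *+ e) = (wt F m * e)%N.
Proof. by rewrite /wt big_distrl; apply: eq_bigr => i _; rewrite mulmnE. Qed.

Section SymbolicPowerRetract.
Variables (I : R -> Prop) (sqfI : sqfree_monomial_ideal I).

Lemma dilate_symb_pow e s t f : (t <= e * s)%N -> symb_pow I s f -> symb_pow I t (dilate e f).
Proof.
move=> tes Hf; rewrite [f]mpolyE rmorph_sum.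
apply: (ideal_sum (symb_pow_is_ideal I t)) => m fm /=.
rewrite /dilate comp_mpolyZ -/(dilate e _) dilateX.
apply: (idealZ (symb_pow_is_ideal I t)); apply: symb_powX => // F minF.
by rewrite wtMn mulnC (leq_trans tes) // leq_mul2l (symb_pow_wt Hf minF fm) orbT.
Qed.

(** A surviving monomial is an e-th power of some x^m', and e wt(m') >= t > e(s - 1) forces wt(m')
    >= s. *)
Lemma contract_symb_pow e s t f : (0 < e)%N -> (e * (s - 1) + 1 <= t)%N ->
  symb_pow I t f -> symb_pow I s (contract e f).
Proof.
move=> e0 est Hf; apply: (ideal_sum (symb_pow_is_ideal I s)) => m fm.
apply: (idealZ (symb_pow_is_ideal I s)); rewrite /contract_mon.
case: ifP => [/forallP em|_]; last exact: ideal0 (symb_pow_is_ideal I s).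
apply: symb_powX => // F minF; set m' := [multinom _ | _ < _].
have Em : m = (m' *+ e)%MM by apply/mnmP => i; rewrite mulmnE mnmE divnK.
have := leq_trans est (symb_pow_wt Hf minF fm); rewrite Em wtMn addn1 mulnC ltn_pmul2r //.
(* Subtraction is truncated, so [s] = 0 is treated apart; there the bound is trivial. *)
by case: s {est Hf} => // s; rewrite subn1.
Qed.

End SymbolicPowerRetract.

(** * Depth *)

Lemma ideal_add_ideal J fs : is_ideal (ideal_add J fs).
Proof. exact: ideal_gen_is_ideal. Qed.

Lemma ideal_add_nil J : is_ideal J -> ideal_add J [::] = J.
Proof.
move=> idJ; apply: pred_ext => f; split; last by move=> Jf; apply: ideal_gen_sub; left.
by apply: ideal_ind => // g [].
Qed.

Lemma ideal_add_cons J f fs : is_ideal J -> ideal_add J (f :: fs) = ideal_add (adjoin J f) fs.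
Proof.
move=> idJ; apply: pred_ext => g; split; apply: ideal_ind; try exact: ideal_add_ideal.
  move=> h [Jh|]; first by apply: ideal_gen_sub; left; exact: adjoin_sub.
  rewrite in_cons => /predU1P[->|hfs]; apply: ideal_gen_sub; last by right.
  by left; exact: adjoin_gen.
move=> h [|hfs]; last by apply: ideal_gen_sub; right; rewrite in_cons hfs orbT.
apply: adjoin_min; first exact: ideal_add_ideal.
  by move=> h' Jh'; apply: ideal_gen_sub; left.
by apply: ideal_gen_sub; right; rewrite mem_head.
Qed.

Definition weakly_regular J (fs : seq R) := forall i, (i < size fs)%N ->
  nonzerodivisor (ideal_add J (take i fs)) (nth 0 fs i).

Lemma weakly_regular_cons J f fs : is_ideal J ->
  weakly_regular J (f :: fs) <-> nonzerodivisor J f /\ weakly_regular (adjoin J f) fs.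
Proof.
move=> idJ; split=> [H|[Hf Hfs] [_|i ifs] /=]; last 2 first.
- by rewrite ideal_add_nil.
- by rewrite ideal_add_cons //; exact: Hfs.
split=> [|i ifs]; first by have := H 0%N isT; rewrite /= ideal_add_nil.
by have := H i.+1 ifs; rewrite /= ideal_add_cons.
Qed.

Lemma has_regular_seqP J d : is_ideal J -> has_regular_seq J d <->
  exists fs, [/\ size fs = d, (forall f, f \in fs -> max_ideal f) & weakly_regular J fs].
Proof.
elim: d J => [|d IH] J idJ; first by split=> // _; exists [::].
split=> [[f [mf regf]]|[[|f fs] [//= [sfs] mfs]]].
  move=> /(IH _ (adjoin_ideal f idJ))[fs [sfs mfs wfs]]; exists (f :: fs); split.
  - by rewrite /= sfs.
  - by move=> g; rewrite in_cons => /predU1P[->|/mfs].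
  - exact/weakly_regular_cons.
move=> /(weakly_regular_cons _ _ idJ)[regf wfs]; exists f; split=> //.
  by apply: mfs; rewrite mem_head.
apply/(IH _ (adjoin_ideal f idJ)); exists fs; split=> // g gfs.
by apply: mfs; rewrite in_cons gfs orbT.
Qed.

Lemma mcoeff0_ideal : is_ideal (fun f : R => f@_0%MM = 0).
Proof.
split=> [|a b /= Ha Hb|r a /= Ha]; first exact: mcoeff0.
  by rewrite mcoeffD Ha Hb addr0.
by rewrite rmorphM /= Ha mulr0.
Qed.

(** The polynomials without constant term form an ideal that contains J and the sequence but not
    1. *)
Lemma ideal_add_proper J fs : (forall f, J f -> f@_0%MM = 0) ->
  (forall f, f \in fs -> max_ideal f) -> ~ ideal_add J fs 1.
Proof.
move=> J0 mfs; suff H f : ideal_add J fs f -> f@_0%MM = 0.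
  by move/H/eqP; rewrite mcoeff1 eqxx oner_eq0.
move: f; apply: ideal_ind; first exact: mcoeff0_ideal.
move=> f [/J0//|/mfs]; move: f; apply: ideal_ind; first exact: mcoeff0_ideal.
by move=> _ [i ->]; rewrite mcoeffX mnm1_eq0.
Qed.

End Ideals.

Theorem theorem2p7 (k : fieldType) (n : nat) (I : {mpoly k[n]} -> Prop) :
  sqfree_monomial_ideal I ->
  forall s t : nat, (1 <= s)%N -> E_set s t ->
  depth_leq (symb_pow I t) (symb_pow I s).
Proof.
move=> sqfI s t s1 [[|e] [] // _ est tes] d Hd.
have idt := symb_pow_is_ideal I t; have ids := symb_pow_is_ideal I s.
have contr f : symb_pow I t f -> symb_pow I s (contract e.+1 f).
  exact: contract_symb_pow.
case: (classic (symb_pow I s 1)) => [|ns1]; [by left | right].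
(* If R/I^(t) = 0, contracting 1 puts 1 in I^(s), which is excluded here. *)
case: Hd => [/contr|[fs [sfs mfs [wfs _]]]]; first by rewrite contract1.
have : has_regular_seq (symb_pow I t) d by apply/has_regular_seqP => //; exists fs.
move/(has_regular_seq_retract (@dilateXU k n e.+1)
  (fun a b => @contract_dilate k n e.+1 a b isT) (contract1 _ _ _) idt ids
  (fun f => dilate_symb_pow sqfI tes) contr).
move=> /(has_regular_seqP _ ids)[gs [sgs mgs wgs]]; exists gs; split=> //; split=> //.
by apply: ideal_add_proper => // f; exact: symb_pow_constant.
Qed.
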